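(* Let $\kappa$ be inaccessible and let $b,h:\kappa\to\kappa$ be increasing functions with $h\leq b$, each $b(\alpha)$ an infinite cardinal and each $h(\alpha)$ a cardinal with $h(\alpha)\geq2$. For each cardinal $\lambda<\kappa$ define $$D_\lambda=\{\alpha\in\kappa\mid b(\alpha)\leq\lambda\}\cup\{\alpha\in\kappa\mid h(\alpha)=b(\alpha)\text{ and }\mathrm{cf}(b(\alpha))\leq\lambda\}.$$ (i) If there exists a least cardinal $\lambda<\kappa$ such that $D_\lambda$ is cofinal in $\kappa$, then $\mathfrak b_\kappa^{b,h}(\not\ni^\infty)=\lambda$. (ii) If $D_\lambda$ is bounded in $\kappa$ for all $\lambda<\kappa$ and there is a stationary set $S\subseteq\kappa$ such that (a) $b$ is continuous on $S$, or (b) for each $\xi\in S$ there exists $\alpha_\xi\geq\xi$ with $h(\alpha_\xi)=b(\alpha_\xi)$ and $\mathrm{cf}(b(\alpha_\xi))\leq\xi$, then $\mathfrak b_\kappa^{b,h}(\not\ni^\infty)=\kappa$. (iii) If $D_\lambda$ is bounded in $\kappa$ for all $\lambda<\kappa$ and there is a club set $C\subseteq\kappa$ such that (a) $b$ is discontinuous on $C$, and (b) for each $\xi\in C$ and $\alpha\geq\xi$, if $h(\alpha)=b(\alpha)$, then $\mathrm{cf}(b(\alpha))>\xi$, then $\kappa^+\leq\mathfrak b_\kappa^{b,h}(\not\ni^\infty)$.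
   Context: ''Increasing'' means not necessarily strictly increasing. An increasing function $b:\kappa\to\mathrm{Ord}$ is continuous (resp. discontinuous) on $A\subseteq\kappa$ if $b(\gamma)=\bigcup_{\alpha<\gamma}b(\alpha)$ (resp. $b(\gamma)>\bigcup_{\alpha<\gamma}b(\alpha)$) for every limit ordinal $\gamma\in A$. $\prod b$ is the set of functions $f$ with domain $\kappa$ and $f(\alpha)\in b(\alpha)$ for all $\alpha$. $\mathrm{Loc}_\kappa^{b,h}$ is the set of functions $\phi$ with domain $\kappa$ such that $\phi(\alpha)\subseteq b(\alpha)$ and $|\phi(\alpha)|<h(\alpha)$ for all $\alpha$. $f\in^\infty\phi$ (equivalently $\phi\ni^\infty f$) means that for every $\beta<\kappa$ there is $\alpha>\beta$ with $f(\alpha)\in\phi(\alpha)$. The antilocalisation cardinal $\mathfrak b_\kappa^{b,h}(\not\ni^\infty)$ is the least size of a set $\Phi\subseteq\mathrm{Loc}_\kappa^{b,h}$ such that for every $f\in\prod b$ there is $\phi\in\Phi$ with $f\in^\infty\phi$. *)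

(* Defs.v *)
From mathcomp Require Import all_boot all_order.
From mathcomp Require Import all_classical.

Set Implicit Arguments.
Unset Strict Implicit.
Unset Printing Implicit Defensive.

Import Order.TTheory.

Local Open Scope classical_set_scope.
Local Open Scope card_scope.
Local Open Scope order_scope.

(* A cardinal number is an equipotence class of types, so that cardinals of
   sets living in different types can be compared. *)
Record cardinal := Cardinal {
  card_class : Type -> Prop;
  card_classP : exists T : Type,
    card_class = fun U : Type => [set: U] #= [set: T]
}.

Definition card_of (T : Type) (A : set T) : cardinal :=
  @Cardinal (fun U : Type => [set: U] #= [set: set_type A])
            (ex_intro _ (set_type A : Type) erefl).

Definition cle (c c' : cardinal) : Prop :=
  exists T U : Type,
    [/\ card_class c T, card_class c' U & [set: T] #<= [set: U]].

Definition clt (c c' : cardinal) : Prop := cle c c' /\ c <> c'.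

Definition is_cmin (P : cardinal -> Prop) (c : cardinal) : Prop :=
  P c /\ forall c', P c' -> cle c c'.

(* The least element of a class of cardinals. Cardinals are well-ordered, so
   the default value is used only for the empty class. *)
Definition cmin (P : cardinal -> Prop) : cardinal :=
  match pselect (exists c, is_cmin P c) with
  | left ex => projT1 (cid ex)
  | right _ => card_of (@set0 unit)
  end.

Definition csucc (c : cardinal) : cardinal := cmin (clt c).

Section Ordinal.
Context {d : Order.disp_t} {K : orderType d}.
Implicit Types (x y alpha beta gamma : K) (A B C S : set K).

(* The ordinal kappa is represented by a well-ordered type K and the ordinals
   below kappa by the elements of K: alpha, viewed as the set of the ordinals
   below alpha, is the initial segment [below alpha]. *)
Definition below alpha : set K := [set x | x < alpha].

Definition ocard alpha : cardinal := card_of (below alpha).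

Definition is_cardinal alpha : Prop :=
  forall beta, beta < alpha -> clt (ocard beta) (ocard alpha).

Definition is_infinite_cardinal alpha : Prop :=
  is_cardinal alpha /\ infinite_set (below alpha).

Definition is_limit alpha : Prop :=
  (exists x, x < alpha) /\
  (forall x, x < alpha -> exists2 y, y < alpha & x < y).

Definition cofinal_in A B : Prop :=
  A `<=` B /\ forall y, B y -> exists2 x, A x & y <= x.

Definition bounded A : Prop := exists beta, A `<=` below beta.

Definition has_cofinal_map alpha B : Prop :=
  exists f : K -> K, cofinal_in (f @` below alpha) B.

(* The least ordinal gamma having a cofinal map into beta. Since beta itself is
   such an ordinal, the default value of xget is irrelevant. *)
Definition cf beta : K :=
  xget beta [set gamma | has_cofinal_map gamma (below beta) /\
    forall gamma', has_cofinal_map gamma' (below beta) -> gamma <= gamma'].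

Definition club C : Prop :=
  cofinal_in C [set: K] /\
  (forall gamma, is_limit gamma ->
    cofinal_in (C `&` below gamma) (below gamma) -> C gamma).

Definition stationary S : Prop :=
  forall C, club C -> S `&` C !=set0.

(* The equality b(gamma) = \bigcup_(alpha < gamma) b(alpha) of ordinals, read
   through the identification of an ordinal with its initial segment. *)
Definition continuous_on (b : K -> K) A : Prop :=
  forall gamma, is_limit gamma -> A gamma ->
    below (b gamma) = \bigcup_(alpha in below gamma) below (b alpha).

Definition discontinuous_on (b : K -> K) A : Prop :=
  forall gamma, is_limit gamma -> A gamma ->
    \bigcup_(alpha in below gamma) below (b alpha) `<` below (b gamma).

Definition prod_set (b : K -> K) : set (K -> K) :=
  [set f | forall alpha, f alpha < b alpha].

Definition Loc (b h : K -> K) : set (K -> set K) :=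
  [set phi | forall alpha, phi alpha `<=` below (b alpha) /\
                           clt (card_of (phi alpha)) (ocard (h alpha))].

Definition in_infty (f : K -> K) (phi : K -> set K) : Prop :=
  forall beta, exists2 alpha, beta < alpha & phi alpha (f alpha).

Definition antiloc_family (b h : K -> K) (Phi : set (K -> set K)) : Prop :=
  Phi `<=` Loc b h /\
  forall f, prod_set b f -> exists2 phi, Phi phi & in_infty f phi.

Definition antiloc (b h : K -> K) : cardinal :=
  cmin (fun c => exists2 Phi, antiloc_family b h Phi & c = card_of Phi).

Definition Dset (b h : K -> K) (lambda : K) : set K :=
  [set alpha | b alpha <= lambda] `|`
  [set alpha | h alpha = b alpha /\ cf (b alpha) <= lambda].

End Ordinal.

(* K, as an ordinal, is a (strongly) inaccessible cardinal: an initial ordinal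
   that is uncountable, regular and a strong limit. *)
Definition inaccessible (d : Order.disp_t) (K : orderType d) : Prop :=
  [/\ wochoice.well_order (<=%O : rel K),
      forall alpha : K, clt (ocard alpha) (card_of [set: K]),
      clt (card_of [set: nat]) (card_of [set: K]),
      forall alpha : K, ~ has_cofinal_map alpha [set: K]
    & forall alpha : K,
        clt (card_of [set X : set K | X `<=` below alpha]) (card_of [set: K])].

(* Main.v *)
(* An element alpha of D_lambda is one for which b(alpha) is covered by lambda
   sets of size < h(alpha): singletons if b(alpha) <= lambda, and the segments
   below a cofinal sequence if h(alpha) = b(alpha) and cf(b(alpha)) <= lambda.
   One choice of covers yields slaloms F(eta), eta < kappa, such that every
   beta < b(alpha) lies in some F(eta)(alpha) with eta < lambda, whatever
   lambda is. Pigeonhole for lambda in (i), and a stationary set in (ii), turn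
   this into the upper bounds; in (ii) the stationary set meets the club of
   limit ordinals closed under a bounding function, which replaces a use of
   Fodor's lemma. Conversely, for alpha outside D_mu the union of mu sets of
   size < h(alpha) has size < b(alpha), by kappa * kappa = kappa for infinite
   cardinals; this gives the lower bounds. In (iii) one diagonalises against
   kappa many slaloms: at alpha the first xi of them are avoided, xi being the
   largest element up to alpha of a club on which xi < b(xi). *)
Require Import Defs.
From mathcomp Require Import all_boot all_order.
From mathcomp Require Import all_classical.

Set Implicit Arguments.
Unset Strict Implicit.
Unset Printing Implicit Defensive.

Import Order.TTheory.

Local Open Scope classical_set_scope.
Local Open Scope card_scope.
Local Open Scope order_scope.

(** * Comparison of sets by injections *)

(** The point [u0] is the value outside [A], so that the injection can be a total function. *)
Lemma card_le_injP (T U : Type) (u0 : U) (A : set T) (B : set U) :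
  A #<= B <-> exists2 f : T -> U, set_fun A B f & set_inj A f.
Proof.
rewrite -injfunPex; split=> [/card_leP[f]|[f]]; last exact: inj_card_le.
by squash (valLR u0 f).
Qed.

(* The recursion sends w to a point of A not yet used by the predecessors of
   w. *)
Lemma card_le_by_segments (W U : Type) (R : W -> W -> Prop) (D : set W)
    (A : set U) :
  well_founded R ->
  (forall v w, v <> w -> R v w \/ R w v) ->
  (forall w, D w -> ~ (A #<= [set v | D v /\ R v w])) ->
  D #<= A.
Proof.
elim/Pchoice: U => U in A *.
move=> wfR totR small.
have [->|/set0P[w0 Dw0]] := eqVneq D set0; first exact: card_ge0.
have [u0 _] : A !=set0.
  by apply/set0P/eqP => A0; apply: (small _ Dw0); rewrite A0; exact: card_ge0.
pose next w (rec : forall v, R v w -> U) : set U :=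
  [set u | A u /\ forall v (Rvw : R v w), D v -> rec v Rvw <> u].
pose g := Fix wfR (fun=> U) (fun w rec => xget u0 (next w rec)).
have gE w : g w = xget u0 [set u | A u /\ forall v, R v w -> D v -> g v <> u].
  rewrite /g Fix_eq// => x f f' ff'.
  congr (xget _ (next _ _)); apply: functional_extensionality_dep => y.
  by apply: functional_extensionality_dep => ?; exact: ff'.
have gP w : D w -> A (g w) /\ forall v, R v w -> D v -> g v <> g w.
  move=> Dw; rewrite [g w]gE; case: xgetP => [u _ //|empty]; exfalso.
  apply: (small _ Dw); apply: card_le_trans (card_image_le g _).
  apply: subset_card_le => u Au; apply: contrapT => gu; apply: (empty u).
  by split=> // v Rvw Dv gvu; apply: gu; exists v.
apply/(card_le_injP u0); exists g => [w /gP[]//|v w].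
rewrite !inE => Dv Dw gvw; apply: contrapT => /totR[Rvw|Rwv].
  by have [_ /(_ _ Rvw Dv)] := gP _ Dw.
by have [_ /(_ _ Rwv Dw)] := gP _ Dv; rewrite gvw.
Qed.

(** Hilbert's hotel: for [a] outside [A] and a sequence [g] in [A], send [a] to [g 0] and [g n] to
    [g n.+1], and fix all other points. *)
Lemma card_setU1_infinite (T : Type) (A : set T) (a : T) :
  infinite_set A -> A `|` [set a] #<= A.
Proof.
have [Aa _|nAa] := pselect (A a).
  by apply: subset_card_le => x [//|->].
move=> /infiniteP/(card_le_injP a)[g gA0 ginj0].
have ginj m n : g m = g n -> m = n by apply: ginj0; rewrite inE.
have gA n : A (g n) by exact: gA0.
pose f x := if pselect (x = a) then g 0 else
  if pselect (exists n, g n = x) is left e then g (projT1 (cid e)).+1 else x.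
have fg n : f (g n) = g n.+1.
  rewrite /f; case: (pselect (g n = a)) => [gna|?] /=.
    by case: nAa; rewrite -gna.
  case: pselect => [e|ne]; last by case: ne; exists n.
  by case: (cid e) => m /= /ginj ->.
have fa : f a = g 0 by rewrite /f; case: (pselect (a = a)).
have fother x : x <> a -> ~ (exists n, g n = x) -> f x = x.
  by move=> xa ng; rewrite /f; case: (pselect (x = a)) => //= ?; case: pselect.
have cases x : (A `|` [set a]) x ->
    [\/ x = a, exists n, x = g n | [/\ A x, f x = x & ~ exists n, g n = x]].
  have [->|xa] := pselect (x = a); first by constructor 1.
  have [[n <-]|ng] := pselect (exists n, g n = x).
    by constructor 2; exists n.
  by move=> [Ax|//]; constructor 3; split=> //; exact: fother.
apply/(card_le_injP a); exists f.
  by move=> x /cases[->|[n ->]|[Ax -> _]//]; rewrite ?fa ?fg; exact: gA.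
move=> x y; rewrite !inE => /cases hx /cases hy.
case: hx => [->|[n ->]|[Ax -> nx]]; case: hy => [->|[m ->]|[Ay -> ny]] //;
  rewrite ?fa ?fg.
- by move=> /ginj.
- by move=> gy; case: ny; exists 0%N.
- by move=> /ginj.
- by move=> /ginj [->].
- by move=> gy; case: ny; exists n.+1.
- by move=> gx; case: nx; exists 0%N.
- by move=> gx; case: nx; exists m.+1.
Qed.

(** * Cardinals as equipotence classes *)

Lemma cardinal_eq (c c' : cardinal) : card_class c = card_class c' -> c = c'.
Proof.
case: c c' => [P p] [Q q] /= PQ; case: _ / PQ q => q.
by congr Cardinal; exact: Prop_irrelevance.
Qed.

Lemma card_of_eq (T U : Type) (A : set T) (B : set U) :
  A #= B -> card_of A = card_of B.
Proof.
move=> AB; apply: cardinal_eq; apply/funext => V /=; apply/propext.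
have AB' : [set: set_type A] #= [set: set_type B].
  by rewrite (card_eql (card_setT _)) (card_eqr (card_setT _)).
by split=> h; rewrite (card_eqr AB') in h *.
Qed.

Lemma card_le_setX (T T' U U' : Type) (A : set T) (B : set T') (C : set U)
    (D : set U') : A #<= C -> B #<= D -> A `*` B #<= C `*` D.
Proof.
move=> AC BD; have [C0|/set0P[c _]] := eqVneq C set0.
  have -> : A `*` B = set0; last exact: card_ge0.
  have /card_le0P -> : A #<= @set0 U by rewrite -C0.
  by rewrite -subset0 => -[x y] [].
have [D0|/set0P[d _]] := eqVneq D set0.
  have -> : A `*` B = set0; last exact: card_ge0.
  have /card_le0P -> : B #<= @set0 U' by rewrite -D0.
  by rewrite -subset0 => -[x y] [].
move/(card_le_injP c): AC => [f fC finj].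
move/(card_le_injP d): BD => [g gD ginj].
apply/(card_le_injP (c, d)); exists (fun p => (f p.1, g p.2)).
  by move=> [x y] [/= /fC ? /gD ?].
move=> [x y] [x' y']; rewrite !inE /= => -[/= Ax By] [/= Ax' By'] [fx gy].
by congr pair; [apply: finj | apply: ginj]; rewrite ?inE.
Qed.

(** All representatives of a class are equipotent, so those chosen in [cle] can be replaced by [A]
    and [B]. *)
Lemma cle_card_of (T U : Type) (A : set T) (B : set U) :
  cle (card_of A) (card_of B) <-> A #<= B.
Proof.
split=> [[V [W []]]|AB] /=.
  move=> VA WB VW.
  rewrite -(card_le_eql (card_setT A)) -(card_le_eqr (card_setT B)).
  by rewrite -(card_le_eql VA) -(card_le_eqr WB).
exists (set_type A), (set_type B); split=> //=.
by rewrite (card_le_eql (card_setT A)) (card_le_eqr (card_setT B)).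
Qed.

Lemma card_of_eqP (T U : Type) (A : set T) (B : set U) :
  card_of A = card_of B <-> A #= B.
Proof.
split=> [AB|]; last exact: card_of_eq.
by rewrite card_eq_le; apply/andP; split; apply/cle_card_of; rewrite AB;
  apply/cle_card_of.
Qed.

Lemma clt_card_of (T U : Type) (A : set T) (B : set U) :
  clt (card_of A) (card_of B) <-> A #<= B /\ ~ (B #<= A).
Proof.
rewrite /clt cle_card_of card_of_eqP card_eq_le; split=> -[AB nBA]; split=> //.
  by move=> BA; apply: nBA; rewrite AB BA.
by rewrite AB.
Qed.

Lemma cardinalP (c : cardinal) : exists T : Type, c = card_of [set: T].
Proof.
have [T cT] := card_classP c; exists T; apply: cardinal_eq => /=; rewrite cT.
apply/funext => V /=; apply/propext.
by rewrite (card_eqr (card_setT [set: T])).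
Qed.

(** * Segments of a well-order and their squares *)

Section WellOrder.
Context {d : Order.disp_t} {K : orderType d}.
Hypothesis K_wo : wochoice.well_order (<=%O : rel K).
Implicit Types (x y m n : K).

Lemma well_order_min (P : set K) :
  P !=set0 -> exists2 x, P x & forall y, P y -> x <= y.
Proof.
move=> [x0 Px0]; have [|x [[xP xmin] _]] := K_wo (A := mem P).
  by exists x0; rewrite inE.
by exists x => [|y Py]; [rewrite inE in xP | apply: xmin; rewrite inE].
Qed.

Lemma lt_well_founded : well_founded (fun x y : K => x < y).
Proof.
move=> x; apply: contrapT => nx.
have [|y ny ymin] :=
  well_order_min (P := [set y | ~ Acc (fun x y : K => x < y) y]).
  by exists x.
apply: ny; constructor => z zy; apply: contrapT => /ymin.
by rewrite leNgt zy.
Qed.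

(** The recursion along [below m] can stop only at an [n] whose segment receives [A]. *)
Lemma card_le_belows (U : Type) (A : set U) (m : K) :
  (forall n, n < m -> ~ (A #<= below n)) -> below m #<= A.
Proof.
move=> small; apply: (card_le_by_segments lt_well_founded) => [x y|n nm].
  by move=> /eqP; rewrite neq_lt => /orP.
move=> An; apply: (small n nm); apply: card_le_trans An _.
by apply: subset_card_le => x [].
Qed.

Lemma card_leT_belows (U : Type) (A : set U) :
  (forall n : K, ~ (A #<= below n)) -> [set: K] #<= A.
Proof.
move=> small; apply: (card_le_by_segments lt_well_founded) => [x y|n _].
  by move=> /eqP; rewrite neq_lt => /orP.
move=> An; apply: (small n); apply: card_le_trans An _.
by apply: subset_card_le => x [].
Qed.

(** The least [n] whose segment receives [A] is a cardinal. This passes from an arbitrary index to a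
    cardinal, for which alone the sets [Dset] are assumed bounded. *)
Lemma card_le_cardinal (U : Type) (A : set U) m : A #<= below m ->
  exists n, [/\ n <= m, is_cardinal n & A #<= below n].
Proof.
move=> Am; have [|n An nmin] := well_order_min (P := [set n | A #<= below n]).
  by exists m.
exists n; split=> //; first exact: nmin.
move=> x xn; apply/clt_card_of; split.
  by apply: subset_card_le => y /= /lt_trans; apply.
move=> nx; have : n <= x by apply: nmin; exact: card_le_trans An nx.
by rewrite leNgt xn.
Qed.

(* Pairs are compared by their maximum first (Goedel's pairing), so the
   predecessors of a pair in [below m `*` below m] lie in a smaller square. *)
Let goedel_lt (p q : K * K) : Prop :=
  Order.max p.1 p.2 < Order.max q.1 q.2 \/
  Order.max p.1 p.2 = Order.max q.1 q.2 /\
    (p.1 < q.1 \/ p.1 = q.1 /\ p.2 < q.2).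

Let goedel_lt_wf : well_founded goedel_lt.
Proof.
(* Three nested inductions, on the maximum and on each coordinate; the equations keep these as
   separate variables. *)
suff H m x y p : Order.max p.1 p.2 = m -> p.1 = x -> p.2 = y -> Acc goedel_lt p.
  by move=> p; exact: H.
elim/(well_founded_ind lt_well_founded): m x y p => m IHm x.
elim/(well_founded_ind lt_well_founded): x => x IHx y.
elim/(well_founded_ind lt_well_founded): y => y IHy p pm px py.
constructor => q [qp|[qp [qx|[qx qy]]]].
- by apply: (IHm (Order.max q.1 q.2) _ q.1 q.2) => //; rewrite -pm.
- by apply: (IHx q.1 _ q.2) => //; rewrite -?px -?pm.
- by apply: (IHy q.2) => //; rewrite -?py -?pm -?px.
Qed.

Let goedel_lt_total p q : p <> q -> goedel_lt p q \/ goedel_lt q p.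
Proof.
rewrite /goedel_lt => pq.
have [?|?|Mpq] := ltgtP (Order.max p.1 p.2) (Order.max q.1 q.2); try by auto.
have [?|?|e1] := ltgtP p.1 q.1; try by auto.
have [?|?|e2] := ltgtP p.2 q.2; try by auto 6.
by case: pq; case: p q e1 e2 {Mpq} => [? ?] [? ?] /= -> ->.
Qed.

(** If [below m] embeds in no smaller segment, the predecessors of a pair lie in a square that is
    finite or, by induction, embeds in a smaller segment; so they cannot receive [below m]. *)
Lemma card_below_setX m : infinite_set (below m) ->
  below m `*` below m #<= below m.
Proof.
elim/(well_founded_ind lt_well_founded): m => m IH minf.
have [[n nm mn]|nomn] := pselect (exists2 n, n < m & below m #<= below n).
  have ninf : infinite_set (below n) by move/(card_le_finite mn).
  apply: card_le_trans (card_le_setX mn mn) _.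
  apply: card_le_trans (IH _ nm ninf) _.
  by apply: subset_card_le => y /= /lt_trans; apply.
apply: (card_le_by_segments goedel_lt_wf goedel_lt_total) => -[x y] [/= xm ym].
set S := [set v | _]; move=> mS.
pose M := Order.max x y; have Mm : M < m by rewrite gt_max xm ym.
(* [L] is the successor of [M]: a coordinate of a predecessor may equal [M]. *)
pose L := below M `|` [set M].
have LE z : z <= M -> L z.
  by rewrite le_eqVlt => /orP[/eqP ->|]; [right | left].
have SL : S #<= L `*` L.
  apply: subset_card_le => -[u v] [_ uv].
  have : Order.max u v <= M by case: uv => [/ltW|[/= -> _]].
  by rewrite ge_max => /andP[/LE ? /LE ?].
have [Mfin|Minf] := pselect (finite_set (below M)).
  apply: minf; apply: card_le_finite (card_le_trans mS SL) _.
  by apply: finite_setX; rewrite finite_setU; split=> //; exact: finite_set1.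
apply: nomn; exists M => //; apply: card_le_trans mS _.
apply: card_le_trans SL _; apply: card_le_trans (IH _ Mm Minf).
by apply: card_le_setX; exact: card_setU1_infinite.
Qed.

(** * Cofinality and small unions *)

(** If [m] were the successor of [x], then [below m] would be the infinite [below x] with one more
    point, hence of the same size. *)
Lemma infinite_cardinal_limit m x : is_infinite_cardinal m -> x < m ->
  exists2 y, y < m & x < y.
Proof.
move=> [mcard minf] xm; apply: contrapT => ny.
have mx : below m `<=` below x `|` [set x].
  move=> y /= ym; case: (ltgtP y x) => [|xy|]; [by left| |by right].
  by case: ny; exists y.
have xinf : infinite_set (below x).
  move=> xfin; apply: minf; apply: sub_finite_set mx _.
  by rewrite finite_setU; split=> //; exact: finite_set1.
have /clt_card_of[_] := mcard _ xm; apply.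
exact: card_le_trans (subset_card_le mx) (card_setU1_infinite _ xinf).
Qed.

Lemma cf_cofinal_map m : has_cofinal_map (cf m) (below m).
Proof.
rewrite /cf; case: xgetP => [y -> []//|empty].
have [|y yP ymin] :=
  well_order_min (P := [set y | has_cofinal_map y (below m)]).
  exists m; exists id; rewrite image_id; split=> // y ym; by exists y.
by case: (empty y); split.
Qed.

Lemma cf_le m n : has_cofinal_map n (below m) -> cf m <= n.
Proof.
rewrite /cf; case: xgetP => [y -> [_]|empty nm]; first exact.
have [|y yP ymin] :=
  well_order_min (P := [set y | has_cofinal_map y (below m)]).
  by exists n.
by case: (empty y); split.
Qed.


(** If [s] had no bound, its composite with a map of [below m] onto [Phi] would be cofinal in [B].
    This serves cofinalities, with [B] a segment, and regularity, with [B] all of [K]. *)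
Lemma not_cofinal_bound (T : Type) (Phi : set T) (s : T -> K) m (B : set K) :
  ~ has_cofinal_map m B -> B !=set0 -> Phi #<= below m -> set_fun Phi B s ->
  exists2 t, B t & forall i, Phi i -> s i < t.
Proof.
move=> nmB [t0 Bt0] /pfcard_geP[->|]; first by exists t0.
move=> /surjfunPex[g ->] sB; apply: contrapT => nt; apply: nmB.
exists (s \o g); split=> [_ [x xm <-]|y By]; first by apply: sB; exists x.
apply: contrapT => ny; apply: nt; exists y => // _ [x xm <-].
by rewrite ltNge; apply/negP => yx; apply: ny; exists (s (g x)) => //; exists x.
Qed.

Lemma is_infinite_cardinal_inhabited m :
  is_infinite_cardinal m -> below m !=set0.
Proof. by move=> [_ /infinite_setN0]. Qed.

(** All [A i] embed in one segment [below t] with [t < m]. If they covered [below m], sending [y] to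
    the index of a set containing it and to its place there would embed [below m] in the square of a
    smaller segment. *)
Lemma small_union_avoid (T : Type) (Phi : set T) (A : T -> set K) m H mu :
  is_infinite_cardinal m -> H <= m -> Phi #<= below mu -> mu < m ->
  (H = m -> mu < cf m) ->
  (forall i, Phi i -> clt (card_of (A i)) (ocard H)) ->
  exists2 y, y < m & forall i, Phi i -> ~ A i y.
Proof.
move=> minf Hm Phimu mum mucf small.
have [y0 y0m] := is_infinite_cardinal_inhabited minf.
have [t tm tA] : exists2 t, t < m & forall i, Phi i -> A i #<= below t.
  have [HltM|] := boolP (H < m).
    by exists H => // i /small /clt_card_of[].
  (* If [H = m], each [A i] embeds in some [below (s i)] with [s i < m], and [mu < cf m] bounds the
     [s i]. *)
  rewrite lt_neqAle Hm andbT negbK => /eqP HM.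
  have /choice[s sP] i : exists si, Phi i -> si < m /\ A i #<= below si.
    have [Pi|] := pselect (Phi i); last by exists y0.
    apply: contrapT => ns; have /clt_card_of[_] := small _ Pi; apply.
    apply: card_le_belows => n nH An; apply: ns; exists n => _.
    by rewrite -HM.
  have [|||t tm st] := not_cofinal_bound (B := below m) (s := s) _ _ Phimu.
  - by move=> /cf_le; rewrite leNgt mucf.
  - by exists y0.
  - by move=> i /sP[].
  exists t => // i Pi; apply: card_le_trans (proj2 (sP _ Pi)) _.
  by apply: subset_card_le => y /= /lt_trans; apply; exact: st.
apply: contrapT => ny.
have [i0 _] : Phi !=set0.
  apply/set0P/eqP => Phi0; apply: ny; exists y0 => // i.
  by rewrite Phi0.
have /choice[g gP] y : exists i, y < m -> Phi i /\ A i y.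
  have [ym|] := pselect (y < m); last by exists i0.
  apply: contrapT => ni; apply: ny; exists y => // i Pi Aiy.
  by apply: ni; exists i.
have /choice[j jP] i : exists j : K -> K, Phi i ->
    set_fun (A i) (below t) j /\ set_inj (A i) j.
  have [Pi|] := pselect (Phi i); last by exists id.
  by have /(card_le_injP y0)[j jt jinj] := tA _ Pi; exists j.
have /(card_le_injP y0)[k kmu kinj] := Phimu.
pose M := Order.max mu t; have Mm : M < m by rewrite gt_max mum tm.
have mM : below m #<= below M `*` below M.
  apply/(card_le_injP (y0, y0)); exists (fun y => (k (g y), j (g y) y)).
    move=> y ym; have [Pg Agy] := gP _ ym; have [jt _] := jP _ Pg.
    by split; rewrite /= /below /= lt_max ?[_ < mu]kmu ?[_ < t]jt ?orbT.
  move=> y y'; rewrite !inE => ym ym' [].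
  have [Pg Ag] := gP _ ym; have [Pg' Ag'] := gP _ ym'.
  move=> /kinj; rewrite !inE => /(_ Pg Pg') gg'; rewrite -gg' in Ag' *.
  by have [_ jinj] := jP _ Pg; apply: jinj; rewrite inE.
have [mcard minfin] := minf; have Minf : infinite_set (below M).
  move=> Mfin; apply: minfin; apply: card_le_finite mM _.
  exact: finite_setX.
have /clt_card_of[_] := mcard _ Mm; apply.
exact: card_le_trans mM (card_below_setX Minf).
Qed.

(** * Slaloms and antilocalising families *)

Section Families.
Context {b h : K -> K}.
Hypothesis h_le_b : forall alpha : K, h alpha <= b alpha.
Hypothesis b_card : forall alpha : K, is_infinite_cardinal (b alpha).
Hypothesis h_card : forall alpha : K, is_cardinal (h alpha).
Hypothesis h_ge2 : forall alpha : K, cle (card_of `I_2) (ocard (h alpha)).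

Lemma clt_bounded_subset (A : set K) m n :
  is_cardinal m -> n < m -> A `<=` below n -> clt (card_of A) (ocard m).
Proof.
move=> mcard /mcard /clt_card_of[nm nmn] An; apply/clt_card_of; split.
  exact: card_le_trans (subset_card_le An) nm.
by move=> mA; apply: nmn; exact: card_le_trans mA (subset_card_le An).
Qed.

Lemma clt_set1_h (y alpha : K) : clt (card_of [set y]) (ocard (h alpha)).
Proof.
have /cle_card_of h2 := h_ge2 alpha; apply/clt_card_of; split.
  by apply: card_le_trans h2; rewrite (card_le_eql card_set1) card_le_II.
by move=> /(card_le_trans h2); rewrite (card_le_eqr card_set1) card_le_II.
Qed.

Lemma Dset_slalom_cover : exists F : K -> K -> set K,
  (forall eta, Loc b h (F eta)) /\
  forall lambda alpha beta, Dset b h lambda alpha -> beta < b alpha ->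
    exists2 eta, eta < lambda & F eta alpha beta.
Proof.
have /choice[c cP] alpha := cf_cofinal_map (b alpha).
(* If [h alpha = b alpha], the value is the segment up to the [eta]-th term of a cofinal map, or
   empty once [eta] reaches the cofinality. Otherwise it is the part of the singleton of [eta] below
   [b alpha]. *)
exists (fun eta alpha => [set z | z < b alpha /\
  ([/\ h alpha = b alpha, eta < cf (b alpha) & z <= c alpha eta] \/
   h alpha <> b alpha /\ z = eta)]); split.
  move=> eta alpha; split=> [z []//|].
  have [hb|nhb] := pselect (h alpha = b alpha); last first.
    have := clt_set1_h eta alpha => /clt_card_of[le1 nle1].
    have sub : [set z | z < b alpha /\
      ([/\ h alpha = b alpha, eta < cf (b alpha) & z <= c alpha eta] \/
      h alpha <> b alpha /\ z = eta)] `<=` [set eta] by move=> z [_ [[]|[]]].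
    apply/clt_card_of; split; first exact: card_le_trans (subset_card_le sub) _.
    by move=> le; apply: nle1; exact: card_le_trans le (subset_card_le sub).
  have [y0 y0b] := is_infinite_cardinal_inhabited (b_card alpha).
  have [etacf|netacf] := boolP (eta < cf (b alpha)); last first.
    apply: (@clt_bounded_subset _ _ y0); rewrite ?hb// -?hb//.
    by move=> z [_ [[]|[]]].
  (* The segment includes its endpoint, so a strict bound still below the limit [b alpha] is
     needed. *)
  have [x xb cx] : exists2 x, x < b alpha & c alpha eta < x.
    apply: infinite_cardinal_limit => //; have [sub _] := cP alpha.
    by apply: sub; exists eta.
  apply: (@clt_bounded_subset _ _ x); rewrite ?hb// -?hb//.
  by move=> z [_ [[_ _ zc]|[]//]]; exact: le_lt_trans zc cx.
move=> lambda alpha beta Dalpha betab.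
have [hb|nhb] := pselect (h alpha = b alpha); last first.
  case: Dalpha => [/= blam|[]//]; exists beta; first exact: lt_le_trans blam.
  by split=> //; right.
(* Either part of [Dset] gives this, since the cofinality of [b alpha] is at most [b alpha]. *)
have cflam : cf (b alpha) <= lambda.
  case: Dalpha => [/=|[]//]; apply: le_trans; apply: cf_le.
  by exists id; rewrite image_id; split=> // y yb; exists y.
have [_ /(_ _ betab)[_ [eta etacf <-] beta_le]] := cP alpha.
by exists eta; [exact: lt_le_trans cflam | split=> //; left].
Qed.

(** Beyond a bound [u] of [Dset b h mu], a function [f] can avoid all slaloms of [Phi] at once, so
    none of them catches it cofinally. *)
Lemma small_family_not_antiloc (Phi : set (K -> set K)) mu :
  antiloc_family b h Phi -> Phi #<= below mu -> bounded (Dset b h mu) -> False.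
Proof.
move=> [PhiLoc Phif] Phimu [u Du].
have /choice[f fP] alpha : exists y, y < b alpha /\
    (u <= alpha -> forall phi, Phi phi -> ~ phi alpha y).
  have [ua|] := leP u alpha; last first.
    by have [y] := is_infinite_cardinal_inhabited (b_card alpha); exists y.
  have nD : ~ Dset b h mu alpha by move=> /Du; rewrite /below /= ltNge ua.
  have [|||y yb yP] := small_union_avoid (A := fun phi => phi alpha)
    (b_card alpha) (h_le_b alpha) Phimu; last by exists y.
  - by rewrite ltNge; apply/negP => ?; apply: nD; left.
  - by move=> hb; rewrite ltNge; apply/negP => ?; apply: nD; right.
  - by move=> phi /PhiLoc /(_ alpha)[].
have [|phi Phiphi /(_ u)[alpha ualpha]] := Phif f.
  by move=> alpha; have [] := fP alpha.
by have [_ /(_ (ltW ualpha) _ Phiphi)] := fP alpha.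
Qed.

(** The singletons of the values of [f] form a slalom that catches [f]. Hence the class minimised in
    [antiloc] is not empty. *)
Lemma Loc_antiloc_family (K_nomax : forall x : K, exists y, x < y) :
  antiloc_family b h (Loc b h).
Proof.
split=> // f fb; exists (fun alpha => [set f alpha]).
  by move=> alpha; split; [move=> _ ->; exact: fb | exact: clt_set1_h].
by move=> beta; have [y ?] := K_nomax beta; exists y.
Qed.

Lemma antiloc_lower_bound (Phi : set (K -> set K)) lambda :
  antiloc_family b h Phi ->
  (forall mu, mu < lambda -> is_cardinal mu -> bounded (Dset b h mu)) ->
  below lambda #<= Phi.
Proof.
move=> PhiP Dbnd.
apply: card_le_belows => n nl /card_le_cardinal[mu [mun mucard]].
move=> /(small_family_not_antiloc PhiP); apply; apply: Dbnd => //.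
exact: le_lt_trans nl.
Qed.

Lemma antiloc_lower_boundT (Phi : set (K -> set K)) :
  antiloc_family b h Phi ->
  (forall mu, is_cardinal mu -> bounded (Dset b h mu)) ->
  [set: K] #<= Phi.
Proof.
move=> PhiP Dbnd; apply: card_leT_belows => n /card_le_cardinal[mu [_ mucard]].
by move=> /(small_family_not_antiloc PhiP); apply; exact: Dbnd.
Qed.

(** If [b] were bounded, its supremum [s] would be a cardinal, being a supremum of cardinals, and
    [Dset b h s] would be all of [K]. *)
Lemma Dset_bounded_unbounded :
  (forall mu, is_cardinal mu -> bounded (Dset b h mu)) ->
  forall x, exists alpha, x < b alpha.
Proof.
move=> Dbnd x; apply: contrapT => nx.
have [|s sub smin] :=
  well_order_min (P := [set s | forall alpha, b alpha <= s]).
  by exists x => alpha; rewrite leNgt; apply/negP => ?; apply: nx; exists alpha.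
have scard : is_cardinal s.
  move=> y ys; have [alpha yb] : exists alpha, y < b alpha.
    apply: contrapT => ny; have : s <= y; last by rewrite leNgt ys.
    apply: smin => alpha; rewrite leNgt; apply/negP => ?; apply: ny.
    by exists alpha.
  have bs : below (b alpha) #<= below s.
    by apply: subset_card_le => z zb; exact: lt_le_trans zb (sub alpha).
  have [bcard _] := b_card alpha; have /clt_card_of[yb1 yb2] := bcard _ yb.
  apply/clt_card_of; split; first exact: card_le_trans yb1 bs.
  by move=> sy; apply: yb2; exact: card_le_trans bs sy.
have [u uP] := Dbnd _ scard.
by have := uP u (or_introl (sub u)); rewrite /below /= ltxx.
Qed.

End Families.

(** * Regularity and clubs of closure points *)

Section Regular.
Hypothesis K_reg : forall alpha : K, ~ has_cofinal_map alpha [set: K].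
Hypothesis K_uncountable : clt (card_of [set: nat]) (card_of [set: K]).
Hypothesis K_initial : forall alpha : K, clt (ocard alpha) (card_of [set: K]).

Lemma no_maximum (x : K) : exists y, x < y.
Proof.
apply: contrapT => nx; have Tx : [set: K] `<=` below x `|` [set x].
  move=> y _; case: (ltgtP y x) => [|xy|]; [by left| |by right].
  by case: nx; exists y.
have [|inf] := pselect (finite_set (below x)).
  move=> fin; have /clt_card_of[] := K_uncountable.
  move=> _ /(_ _) []; apply: finite_set_countable; apply: sub_finite_set Tx _.
  by rewrite finite_setU; split=> //; exact: finite_set1.
have /clt_card_of[_] := K_initial x; apply.
exact: card_le_trans (subset_card_le Tx) (card_setU1_infinite _ inf).
Qed.

Lemma regular_bound (T : Type) (Phi : set T) (s : T -> K) m :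
  Phi #<= below m -> exists t, forall i, Phi i -> s i < t.
Proof.
move=> Phim; have [||t _ tP] := not_cofinal_bound (s := s) (@K_reg m) _ Phim.
- by exists m.
- by [].
- by exists t.
Qed.

(** Limits are required so that continuity of [b], or closedness of a club, applies at these
    points. *)
Definition closure_points (e : K -> K) : set K :=
  [set gamma | is_limit gamma /\ forall x, x < gamma -> e x < gamma].

(** For cofinality, a function [s] bounding [e] on segments is iterated from [y]; the supremum of
    the iterates is a closure point, and it exists by regularity because [nat] embeds in a
    segment. *)
Lemma closure_points_club e : club (closure_points e).
Proof.
split; last first.
  move=> gamma glim [_ gcof]; split=> // x /(proj2 glim)[y yg xy].
  have [c [[_ ce] cg] yc] := gcof _ yg.
  by apply: lt_trans cg; apply: ce; exact: lt_le_trans yc.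
split=> // y _.
have [w natw] : exists w : K, [set: nat] #<= below w.
  apply: contrapT => nw; have /clt_card_of[_] := K_uncountable; apply.
  by apply: card_leT_belows => n nn; apply: nw; exists n.
have /choice[s sP] z : exists u, z < u /\ forall x, x <= z -> e x < u.
  have [z' zz'] := no_maximum z.
  have [u uP] :=
    regular_bound (fun x => Order.max x (e x)) (card_lexx (below z')).
  exists u; split=> [|x xz].
    by have := uP _ zz'; rewrite gt_max => /andP[].
  by have := uP _ (le_lt_trans xz zz'); rewrite gt_max => /andP[].
pose a (k : nat) := iter k s y.
have aS (k : nat) : a k < a k.+1 by have [] := sP (a k).
have [|g gub gmin] := well_order_min (P := [set u | forall k : nat, a k <= u]).
  have [t tP] := regular_bound a natw.
  by exists t => k; apply/ltW/tP.
have ag (k : nat) : a k < g by exact: lt_le_trans (gub k.+1).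
have ga x : x < g -> exists k : nat, x < a k.
  move=> xg; apply: contrapT => nx; have : g <= x; last by rewrite leNgt xg.
  by apply: gmin => k; rewrite leNgt; apply/negP => xa; apply: nx; exists k.
exists g; last exact: ltW (ag 0%N).
split=> [|x /ga[k xk]].
  split; first by exists y; exact: (ag 0%N).
  by move=> x /ga[k xk]; exists (a k).
by apply: lt_trans (ag k.+1); have [_] := sP (a k); apply; exact: ltW.
Qed.

(* A limit of closure points is again one, so the supremum is attained. *)
Lemma closure_points_max e alpha :
  (exists2 g, closure_points e g & g <= alpha) ->
  exists g, [/\ closure_points e g, g <= alpha &
    forall g', closure_points e g' -> g' <= alpha -> g' <= g].
Proof.
move=> [g0 eg0 g0a].
have [|g gub gmin] := well_order_min
  (P := [set u | forall g', closure_points e g' -> g' <= alpha -> g' <= u]).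
  by exists alpha.
have ga : g <= alpha by exact: gmin.
exists g; split=> //; apply: contrapT => ng.
(* As the supremum [g] is assumed not to be a closure point, the closure points up to [alpha]
   approach it strictly from below. *)
have below_g x : x < g -> exists2 c, closure_points e c & x < c < g.
  move=> xg; apply: contrapT => nx; have : g <= x; last by rewrite leNgt xg.
  apply: gmin => c ec ca; rewrite leNgt; apply/negP => xc; apply: nx.
  exists c => //; rewrite xc /= lt_neqAle gub// andbT.
  by apply/eqP => cg; apply: ng; rewrite -cg.
apply: (ng); apply: (proj2 (closure_points_club e)).
  split; last by move=> x /below_g[c _ /andP[xc cg]]; exists c.
  exists g0; rewrite lt_neqAle gub// andbT; apply/eqP => g0g; apply: ng.
  by rewrite -g0g.
split; first by move=> x [].
by move=> x /below_g[c ec /andP[xc cg]]; exists c => //; exact: ltW.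
Qed.

End Regular.
End WellOrder.

(** * Existence of least cardinals *)

Lemma cle_antisym c c' : cle c c' -> cle c' c -> c = c'.
Proof.
have [T ->] := cardinalP c; have [U ->] := cardinalP c'.
move=> /cle_card_of TU /cle_card_of UT; apply/card_of_eqP.
by rewrite card_eq_le TU UT.
Qed.

(** Well-order a representative of [c0]. If no cardinal in [P] embeds in a proper segment, [c0] is
    least; otherwise a cardinal in [P] that embeds in the first possible segment is least. *)
Lemma is_cmin_ex (P : cardinal -> Prop) c0 : P c0 -> exists c, is_cmin P c.
Proof.
have [T ->] := cardinalP c0; elim/Pchoice: T => T PT.
have [R Rwo] := wochoice.well_ordering_principle T.
have woT : wochoice.wo_chain R predT by move=> A _; exact: Rwo.
have Ranti x y : R x y && R y x -> x = y.
  exact: wochoice.wo_chain_antisymmetric woT _ _ isT isT.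
have Rmin (Q : set T) : Q !=set0 -> exists2 x, Q x & forall y, Q y -> R x y.
  move=> [x0 Qx0]; have [|x [[xQ xmin] _]] := Rwo (mem Q).
    by exists x0; rewrite inE.
  by exists x => [|y Qy]; [rewrite inE in xQ | apply: xmin; rewrite inE].
pose S x y := x <> y /\ R x y.
have Swf : well_founded S.
  move=> x; apply: contrapT => nx.
  have [|y ny ymin] := Rmin [set y | ~ Acc S y]; first by exists x.
  apply: ny; constructor => z [zy Rzy]; apply: contrapT => /ymin Ryz.
  by apply: zy; apply: Ranti; rewrite Rzy.
have Stot x y : x <> y -> S x y \/ S y x.
  move=> xy; have [|z + zmin] := Rmin [set x; y]; first by exists x; left.
  case=> zE; [left|right]; split=> //.
  - by rewrite -zE; apply: zmin; right.
  - exact: nesym.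
  - by rewrite -zE; apply: zmin; left.
have [[w [c [Pc cw]]]|noseg] :=
    pselect (exists w c, P c /\ cle c (card_of [set v | S v w])); last first.
  exists (card_of [set: T]); split=> // c' Pc'; have [U c'U] := cardinalP c'.
  rewrite c'U; apply/cle_card_of; apply: (card_le_by_segments Swf Stot) => w _.
  move=> Uw; apply: noseg; exists w, c'; split=> //; rewrite c'U.
  apply/cle_card_of; apply: card_le_trans Uw _.
  by apply: subset_card_le => v [].
have [|w0 [c1 [Pc1 c1w]] wmin] :=
    Rmin [set w | exists c, P c /\ cle c (card_of [set v | S v w])].
  by exists w, c.
exists c1; split=> // c' Pc'; have [U c'U] := cardinalP c'.
move: c1w; have [V ->] := cardinalP c1; rewrite c'U => /cle_card_of Vw.
apply/cle_card_of; apply: card_le_trans Vw _.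
apply: (card_le_by_segments Swf Stot) => v [vw Rvw] Uv.
apply: vw; apply: Ranti; rewrite Rvw; apply: wmin.
exists c'; split=> //; rewrite c'U; apply/cle_card_of.
by apply: card_le_trans Uv _; apply: subset_card_le => u [].
Qed.

Lemma cminP (P : cardinal -> Prop) c0 : P c0 -> is_cmin P (cmin P).
Proof.
by move=> /is_cmin_ex ex; rewrite /cmin; case: pselect => // e; case: (cid e).
Qed.

Lemma cmin_eq (P : cardinal -> Prop) c : is_cmin P c -> cmin P = c.
Proof.
move=> [Pc cle_c]; have [Pmin cle_min] := cminP Pc.
by apply: cle_antisym; [exact: cle_min | exact: cle_c].
Qed.

(** * The three cases *)

Theorem lemma3p35 (d : Order.disp_t) (K : orderType d)
    (K_inaccessible : inaccessible K)
    (b h : K -> K)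
    (b_increasing : forall alpha beta : K, alpha <= beta -> b alpha <= b beta)
    (h_increasing : forall alpha beta : K, alpha <= beta -> h alpha <= h beta)
    (h_le_b : forall alpha : K, h alpha <= b alpha)
    (b_card : forall alpha : K, is_infinite_cardinal (b alpha))
    (h_card : forall alpha : K, is_cardinal (h alpha))
    (h_ge2 : forall alpha : K, cle (card_of `I_2) (ocard (h alpha))) :
  [/\ (* (i) *)
      forall lambda : K,
        is_cardinal lambda ->
        cofinal_in (Dset b h lambda) [set: K] ->
        (forall mu : K, is_cardinal mu ->
           cofinal_in (Dset b h mu) [set: K] -> lambda <= mu) ->
        antiloc b h = ocard lambda,
      (* (ii) *)
      (forall lambda : K, is_cardinal lambda -> bounded (Dset b h lambda)) ->
      (exists2 S : set K, stationary S &
         continuous_on b S \/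
         (forall xi : K, S xi -> exists alpha : K,
            [/\ xi <= alpha, h alpha = b alpha & cf (b alpha) <= xi])) ->
      antiloc b h = card_of [set: K]
    & (* (iii) *)
      (forall lambda : K, is_cardinal lambda -> bounded (Dset b h lambda)) ->
      (exists C : set K,
         [/\ club C, discontinuous_on b C &
             forall xi alpha : K, C xi -> xi <= alpha ->
               h alpha = b alpha -> xi < cf (b alpha)]) ->
      cle (csucc (card_of [set: K])) (antiloc b h)].
Proof.
have [K_wo K_initial K_uncountable K_reg _] := K_inaccessible.
have K_nomax := no_maximum K_uncountable K_initial.
have [F [FLoc Fcover]] := Dset_slalom_cover K_wo b_card h_card h_ge2.
have lowerT := antiloc_lower_boundT K_wo h_le_b b_card.
split.
- move=> lambda lcard [_ Dcof] lmin.
  have lower Phi : antiloc_family b h Phi -> below lambda #<= Phi.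
    move=> PhiP; apply: (antiloc_lower_bound K_wo h_le_b b_card PhiP).
    move=> mu mul mucard; apply: contrapT => nbnd.
    suff : lambda <= mu by rewrite leNgt mul.
    apply: lmin => //; split=> // y _; apply: contrapT => ny; apply: nbnd.
    exists y => alpha Da; rewrite /below /= ltNge; apply/negP => ya.
    by apply: ny; exists alpha.
  have FP : antiloc_family b h (F @` below lambda).
    split=> [_ [eta _ <-]|f fb]; first exact: FLoc.
    apply: contrapT => nf.
    have /choice[e eP] eta : exists e, eta < lambda ->
        forall alpha, e < alpha -> ~ F eta alpha (f alpha).
      have [etal|] := pselect (eta < lambda); last by exists eta.
      apply: contrapT => ne; apply: nf; exists (F eta); first by exists eta.
      move=> beta; apply: contrapT => nb; apply: ne; exists beta => _.
      by move=> alpha ba Fa; apply: nb; exists alpha.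
    (* Regularity bounds the stages after which [f] escapes each [F eta]; a point of
       [Dset b h lambda] beyond the bound contradicts the covering property. *)
    have [u uP] := regular_bound K_reg e (card_lexx (below lambda)).
    have [alpha Da ua] := Dcof u I.
    have [eta etal Feta] := Fcover _ _ _ Da (fb alpha).
    by apply: (eP eta etal alpha) Feta; exact: lt_le_trans (uP _ etal) ua.
  apply: cmin_eq; split=> [|_ [Phi PhiP ->]]; last first.
    by apply/cle_card_of; exact: lower.
  exists (F @` below lambda) => //; apply/card_of_eqP.
  by rewrite card_eq_le lower//= card_image_le.
- move=> Dbnd [S Sstat Scond].
  have FP : antiloc_family b h (range F).
    split=> [_ [eta _ <-]|f fb]; first exact: FLoc.
    apply: contrapT => nf.
    have /choice[e eP] eta : exists e,
        forall alpha, e < alpha -> ~ F eta alpha (f alpha).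
      apply: contrapT => ne; apply: nf; exists (F eta); first by exists eta.
      move=> beta; apply: contrapT => nb; apply: ne; exists beta => alpha ba Fa.
      by apply: nb; exists alpha.
    (* Closure under [e] makes [f] escape every [F eta] with [eta < xi] from [xi] on; closure under
       [b] gives [b xi <= xi] wherever [b] is continuous. *)
    have [xi [Sxi [xilim xiP]]] := Sstat _ (closure_points_club K_wo K_reg
      K_uncountable K_initial (fun x => Order.max (e x) (b x))).
    have [alpha xia Dalpha] : exists2 alpha, xi <= alpha & Dset b h xi alpha.
      case: Scond => [bcont|/(_ _ Sxi)[alpha [xia hb cfb]]]; last first.
        by exists alpha => //; right.
      exists xi => //; left; rewrite /= leNgt; apply/negP => xib.
      have : below (b xi) xi by [].
      rewrite bcont// => -[x xxi xbx]; have := xiP _ xxi.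
      by rewrite gt_max => /andP[_]; rewrite ltNge (ltW xbx).
    have [eta etaxi Feta] := Fcover _ _ _ Dalpha (fb alpha).
    apply: (eP eta alpha) Feta; apply: lt_le_trans xia.
    by have := xiP _ etaxi; rewrite gt_max => /andP[].
  apply: cmin_eq; split=> [|_ [Phi PhiP ->]]; last first.
    by apply/cle_card_of; exact: lowerT.
  exists (range F) => //; apply/card_of_eqP.
  by rewrite card_eq_le lowerT//= card_image_le.
move=> Dbnd [C [Cclub bdisc Ccf]].
have [[Phi PhiP PhiE] _] : is_cmin
    (fun c => exists2 Phi, antiloc_family b h Phi & c = card_of Phi)
    (antiloc b h).
  apply: cminP; exists (Loc b h) => //.
  exact: Loc_antiloc_family.
rewrite PhiE.
suff ltKPhi : clt (card_of [set: K]) (card_of Phi).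
  by have [_] := cminP ltKPhi; apply.
apply/clt_card_of; split; first exact: lowerT.
have [x0 _] : [set: K] !=set0.
  by apply/set0P/eqP => K0; have /clt_card_of[_] := K_uncountable; rewrite K0.
(* If [Phi] is not larger than [K], the injection [i] ranks its slaloms by ordinals. *)
move=> /(card_le_injP x0)[i _ iinj].
have [[_ Ccof] Cclosed] := Cclub.
have b_unbounded := Dset_bounded_unbounded K_wo b_card Dbnd.
have /choice[e eP] x : exists u, [/\ C u, x < u & x < b u].
  have [y xy] := K_nomax x; have [a xba] := b_unbounded x.
  have [u Cu] := Ccof (Order.max y a) I; rewrite ge_max => /andP[yu au].
  exists u; split=> //; first exact: lt_le_trans xy yu.
  by apply: lt_le_trans xba _; exact: b_increasing.
have cpC g : closure_points e g -> C g.
  move=> [glim ge]; apply: Cclosed => //; split=> [x []//|y yg].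
  by have [Cey /ltW yey _] := eP y; exists (e y) => //; split=> //; exact: ge.
(* If [b g <= g], every [y < b g] satisfies [e y < g] and [y < b (e y)], which contradicts
   discontinuity at [g]. *)
have cpb g : closure_points e g -> g < b g.
  move=> cpg; have [glim ge] := cpg; rewrite ltNge; apply/negP => bg.
  have [_ ] := bdisc _ glim (cpC _ cpg); apply => y yb.
  by exists (e y); [apply: ge; exact: lt_le_trans yb bg | have [] := eP y].
(* It suffices to treat the largest closure point [g] up to [alpha]: fewer than [b alpha] slaloms
   have rank below it, and condition (b) on [C] covers the case [h alpha = b alpha]. *)
have /choice[f fP] alpha : exists y, y < b alpha /\
    forall g, closure_points e g -> g <= alpha ->
    forall phi, Phi phi -> i phi < g -> ~ phi alpha y.
  have [ex|nex] := pselect (exists2 g, closure_points e g & g <= alpha);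
      last first.
    have [y yb] := is_infinite_cardinal_inhabited (b_card alpha).
    by exists y; split=> // g cpg ga; case: nex; exists g.
  have [g [cpg ga gmax]] :=
    closure_points_max K_wo K_reg K_uncountable K_initial ex.
  pose Psi : set (K -> set K) := [set phi | Phi phi /\ i phi < g].
  have Psig : Psi #<= below g.
    apply/(card_le_injP x0); exists i => [phi []//|phi psi].
    by rewrite !inE => -[? _] [? _]; apply: iinj; rewrite inE.
  have [||phi [/(proj1 PhiP) /(_ alpha)[]//]|y yb yP] :=
    small_union_avoid K_wo (A := fun phi => phi alpha)
    (b_card alpha) (h_le_b alpha) Psig.
  - by apply: lt_le_trans (cpb _ cpg) _; exact: b_increasing.
  - by move=> hb; apply: Ccf => //; exact: cpC.
  exists y; split=> // g' cpg' g'a phi Phiphi ig'; apply: yP; split=> //.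
  by apply: lt_le_trans ig' _; exact: gmax.
have [|phi Phiphi phif] := proj2 PhiP f.
  by move=> alpha; have [] := fP alpha.
have [y iy] := K_nomax (i phi).
have [[_ cpcof] _] := closure_points_club K_wo K_reg K_uncountable K_initial e.
(* From a closure point above the rank of [phi] on, [f] avoids [phi]. *)
have [g cpg yg] := cpcof y I; have [alpha galpha phi_alpha] := phif g.
have [_ /(_ g cpg (ltW galpha) phi Phiphi)] := fP alpha.
by apply=> //; exact: lt_le_trans yg.
Qed.
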